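(* Let $\mathcal{H}$ be a separable complex Hilbert space and let $T \in \mathcal{B}(\mathcal{H})$. The following are equivalent: (1) $T$ is a product of two projections, i.e. $T = P_1P_2$ for some projections $P_1, P_2 \in \mathcal{B}(\mathcal{H})$. (2) $T = P_{\overline{\operatorname{ran} T}}\, P_{\overline{\operatorname{ran} T^*}}$. (3) $T T^* = T P_{\overline{\operatorname{ran} T}}$. (4) $T T^* T = T^2$.
   Context: $\mathcal{B}(\mathcal{H})$ denotes the bounded linear operators on $\mathcal{H}$. A projection is an orthogonal projection: $P \in \mathcal{B}(\mathcal{H})$ with $P = P^* = P^2$. For a closed subspace $\mathcal{S}$ of $\mathcal{H}$, $P_{\mathcal{S}}$ denotes the orthogonal projection of $\mathcal{H}$ onto $\mathcal{S}$. *)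

(* Defs.v *)
From HB Require Import structures.
From mathcomp Require Import all_boot all_order all_algebra.
From mathcomp Require Import all_classical all_reals all_analysis.
From mathcomp Require Import complex sesquilinear.

Set Implicit Arguments.
Unset Strict Implicit.
Unset Printing Implicit Defensive.

Import Order.TTheory GRing.Theory Num.Theory.
Import numFieldNormedType.Exports.

Local Open Scope classical_set_scope.
Local Open Scope ring_scope.

(* [{dot H for conj}] is a positive definite form, linear in its first argument
   and conjugate-linear in its second. *)
Record hilbertSpace (R : realType) := HilbertSpace {
  hilbert_sort :> completeNormedModType R[i];
  inner : {dot hilbert_sort for (@Num.conj R[i])};
  inner_norm : forall x : hilbert_sort, inner x x = `|x| ^+ 2
}.

Section Operators.
Context {R : realType} {H : hilbertSpace R}.
Implicit Types (T P : H -> H) (S : set H).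

Definition bounded_operator T : Prop :=
  linear T /\ exists M : R, forall x, `|T x| <= M%:C%C * `|x|.

(* [adjoint T y] is the vector [z] with <T x, y> = <x, z> for all [x]; such a
   [z] is unique, and it exists when [T] is bounded (Riesz). *)
Definition adjoint T : H -> H := fun y =>
  xget 0 [set z | forall x, inner H (T x) y = inner H x z].

Definition projection P : Prop :=
  [/\ bounded_operator P, P = adjoint P & P = P \o P].

(* The orthogonal projection of [x] onto [S] is the vector [y] of [S] with
   [x - y] orthogonal to [S]; it is unique, and it exists when [S] is a closed
   subspace. *)
Definition proj_onto S : H -> H := fun x =>
  xget 0 [set y | S y /\ forall z, S z -> inner H (x - y) z = 0].

End Operators.

Definition separable (X : topologicalType) : Prop :=
  exists2 D : set X, countable D & dense D.

(* Main.v *)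
Require Import Defs.
From mathcomp Require Import all_boot all_order all_algebra.
From mathcomp Require Import all_classical all_reals all_analysis.
From mathcomp Require Import complex sesquilinear ring lra.

Set Implicit Arguments.
Unset Strict Implicit.
Unset Printing Implicit Defensive.

Import Order.TTheory GRing.Theory Num.Theory.
Import numFieldNormedType.Exports.

Local Open Scope classical_set_scope.
Local Open Scope ring_scope.

(** Write [P] and [Q] for the orthogonal projections onto the closures of the
    ranges of [T] and of its adjoint [T*].  For every bounded [T] one has
    [P T = T] and [T Q = T], and [Q] vanishes on the kernel of [T], since that
    kernel is the orthogonal complement of [ran T*].

    If [T = P1 P2] for projections [P1] and [P2], then [T* = P2 P1], so that
    [P1] fixes the closure of [ran T] and [P2] fixes that of [ran T*].  Hence
    [P P1 = P] and [P2 Q = Q], and [T = P T Q = (P P1) (P2 Q) = P Q]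
    ([factors_absorb]).  From [T = P Q] one gets [T* = Q P] and
    [T T* = T Q P = T P] ([comp_adjoint_of_factorization]); composing with [T]
    on the right and using [P T = T] yields the cubic identity.

    The converse [factorization_of_cubic] is the substantial step.
    [T T* T = T T] says that [T T*] and [T] agree on [ran T], hence on its
    closure, so [T T* = T T* P = T P].  Therefore [T* - P] takes values in
    the kernel of [T], where [Q] vanishes, and [T* = Q T* = Q P].  Taking
    adjoints gives [T = P Q].

    Continuity of adjoints never enters: equalities of vectors pass from a
    subspace to its closure by testing them against a fixed vector [w], because
    the orthogonal complement of [w] is closed ([orthogonal_closure]).

    The existence of [P], [Q] and [T*] rests on two classical facts for Hilbert
    spaces, the projection theorem ([projection_theorem]) and the Riesz
    representation theorem ([riesz_representation]). *)

Section HilbertGeometry.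
Context {R : realType} {H : hilbertSpace R}.
Implicit Types (u v w x y z : H) (S : set H).

Local Notation "''[' u , v ]" := (inner H u v) : ring_scope.

(** * Inner product estimates *)

Lemma innerC u v : '[u, v] = '[v, u]^*.
Proof. by rewrite hermC /= expr0 mul1r. Qed.

Lemma innerZl a u v : '[a *: u, v] = a * '[u, v].
Proof. exact: linearZl_LR. Qed.

Lemma innerDl u v w : '[u + v, w] = '[u, w] + '[v, w].
Proof. exact: linearDl. Qed.

Lemma innerBl u v w : '[u - v, w] = '[u, w] - '[v, w].
Proof. exact: linearBl. Qed.

Lemma inner0l w : '[0, w] = 0.
Proof. exact: linear0l. Qed.

Lemma innerZr a u v : '[u, a *: v] = a^* * '[u, v].
Proof. exact: linearZr_LR. Qed.

Lemma innerDr u v w : '[w, u + v] = '[w, u] + '[w, v].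
Proof. exact: linearD. Qed.

Lemma innerBr u v w : '[w, u - v] = '[w, u] - '[w, v].
Proof. exact: linearB. Qed.

Lemma inner0r w : '[w, 0] = 0.
Proof. exact: linear0r. Qed.

Lemma inner_extl u v : (forall w, '[u, w] = '[v, w]) -> u = v.
Proof.
move=> uv; apply/eqP; rewrite -subr_eq0 -(dnorm_eq0 (inner H)).
by rewrite innerBl uv subrr.
Qed.

Lemma inner_extr u v : (forall w, '[w, u] = '[w, v]) -> u = v.
Proof. by move=> uv; apply: inner_extl => w; rewrite innerC uv -innerC. Qed.

Lemma parallelogram u v :
  `|u + v| ^+ 2 + `|u - v| ^+ 2 = (`|u| ^+ 2 + `|v| ^+ 2) *+ 2.
Proof.
rewrite -!inner_norm innerBl innerDl !innerBr !innerDr.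
by ring.
Qed.

(** The orthogonal component of [u] along the line spanned by [z] has squared
    length [|<u, z>|^2 / |z|^2], and it is exactly what subtracting the best
    multiple of [z] gains.  With [m = 0] this is the Cauchy-Schwarz inequality;
    with [m] a squared distance to a subspace it shows that almost nearest
    points are almost orthogonal projections. *)
Lemma inner_sqr_le_defect (m : R[i]) u z :
    (forall a : R[i], m <= `|u - a *: z| ^+ 2) ->
  `|'[u, z]| ^+ 2 <= (`|u| ^+ 2 - m) * `|z| ^+ 2.
Proof.
move=> m_le; have [->|z0] := eqVneq z 0.
  by rewrite inner0r !normr0 expr0n mulr0.
have zz_gt0 : 0 < '[z, z] by rewrite dnorm_gt0.
have zzJ : '[z, z]^* = '[z, z] by rewrite -innerC.
have zz0 : '[z, z] != 0 by rewrite gt_eqF.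
(* the coefficient [a] for which [u - a *: z] is orthogonal to [z] *)
have := m_le ('[u, z] / '[z, z]).
rewrite -!inner_norm normCK innerBl !innerBr !innerZl !innerZr.
rewrite rmorphM fmorphV /= zzJ (innerC z u) divfK//.
rewrite [X in _ <= _ - X]subrr subr0 -(ler_pM2r zz_gt0) => m_le_min.
rewrite mulrBl lerBrDr addrC -lerBrDr (le_trans m_le_min)//.
rewrite mulrBl lerD2l lerN2 mulrAC divfK// mulrC.
exact: lexx.
Qed.

Lemma inner_le_norm u z : `|'[u, z]| <= `|u| * `|z|.
Proof.
rewrite -(ler_pXn2r (_ : 0 < 2)%N)// ?nnegrE ?mulr_ge0//.
rewrite exprMn -[`|u| ^+ 2]subr0.
by apply: inner_sqr_le_defect => a; rewrite exprn_ge0.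
Qed.

Lemma eq0_le_small (a b : R[i]) :
  (forall e : R, 0 < e -> `|a| <= e%:C%C * b) -> a = 0.
Proof.
move=> a_le; have := a_le 1 ltr01; rewrite mul1r => ab.
have b0 : 0 <= b by rewrite (le_trans _ ab).
have aE : `|a| = (complex.Re `|a|)%:C%C by rewrite RRe_real// normr_real.
have bE : b = (complex.Re b)%:C%C by rewrite RRe_real// ger0_real.
apply/eqP/contraT => a_neq0.
have : 0 < `|a| by rewrite normr_gt0.
move: a_le ab; rewrite aE bE; set x := complex.Re `|a|; set y := complex.Re b.
rewrite lecR ltcR => a_le xy x0; have y0 := lt_le_trans x0 xy.
have e0 : 0 < x / (y *+ 2) by rewrite divr_gt0// pmulrn_rgt0.
have := a_le _ e0; rewrite -rmorphM lecR.
have -> : x / (y *+ 2) * y = x / 2 by field; rewrite gt_eqF.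
lra.
Qed.

(** Estimating [f] near a limit point [u] of its zeros gives
    [|f u| <= M e] for every [e > 0]; the Lipschitz form keeps the argument
    inside the order of the scalars. *)
Lemma closed_zeros (f : H -> R[i]) (M : R[i]) : 0 <= M ->
    (forall u v, `|f u - f v| <= M * `|u - v|) ->
  closed [set u | f u = 0].
Proof.
move=> M0 f_lip u clu; apply: (@eq0_le_small _ M) => e e0.
have e0' : 0 < e%:C%C :> R[i] by rewrite ltcR.
have [v [/= fv0]] := clu _ (nbhsx_ballx u _ e0').
rewrite -ball_normE /= => uv.
have := f_lip u v; rewrite fv0 subr0 => /le_trans; apply.
by rewrite mulrC ler_wpM2r// ltW.
Qed.

(** * Orthogonal projections onto closed subspaces *)

Definition closed_subspace S :=
  [/\ closed S, S 0 & forall a u v, S u -> S v -> S (a *: u + v)].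

(** Let [d] be the infimum of the squared distances from [x] to [S].  By the
    parallelogram law, points of [S] whose squared distance to [x] is below
    [d + e] lie within [2 sqrt e] of each other, so these sets of almost nearest
    points generate a Cauchy filter.  Its limit [y] is in [S], and by
    [inner_sqr_le_defect] the products [<x - s, z>] tend to [0] along it. *)
Lemma projection_theorem S x : closed_subspace S ->
  exists y, S y /\ forall z, S z -> '[x - y, z] = 0.
Proof.
move=> [clS S0 Slin].
pose N u : R := complex.Re `|u|.
have normE u : `|u| = (N u)%:C%C by rewrite RRe_real// normr_real.
have norm2E u : `|u| ^+ 2 = (N u ^+ 2)%:C%C by rewrite normE -rmorphXn.
pose E := [set N (x - s) ^+ 2 | s in S].
have E_inf : has_inf E.
  split; first by exists (N (x - 0) ^+ 2), 0.
  by exists 0 => _ [s _ <-]; apply: sqr_ge0.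
pose d := inf E.
have d_le s : S s -> d <= N (x - s) ^+ 2.
  by move=> Ss; apply: ge_inf; [case: E_inf | exists s].
pose A (e : R) := [set s | S s /\ N (x - s) ^+ 2 < d + e].
pose F := filter_from [set e : R | 0 < e] A.
have FF : ProperFilter F.
  apply: filter_from_proper; last first.
    move=> e /= e0; have [_ [s Ss <-] ?] := inf_adherent e0 E_inf.
    by exists s.
  apply: filter_from_filter; first by exists 1 => /=.
  move=> e1 e2 /= e10 e20; exists (Num.min e1 e2); first by rewrite /= lt_min e10.
  move=> s [Ss]; rewrite -ltrBlDl lt_min => /andP[? ?].
  by split; split=> //; rewrite -ltrBlDl.
have FA e : 0 < e -> F (A e) by exists e.
have A_dist e s t : A e s -> A e t -> N (s - t) ^+ 2 < 4 * e.
  move=> [Ss ds] [St dt].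
  have Sm : S (2^-1 *: (s + t)).
    have Sst : S (s + t) by have := Slin 1 s t Ss St; rewrite scale1r.
    by have := Slin 2^-1 (s + t) 0 Sst S0; rewrite addr0.
  (* the midpoint of [s] and [t] is in [S], hence not closer to [x] than [d] *)
  have /d_le := Sm.
  have : N ((x - s) + (x - t)) ^+ 2 = 4 * N (x - 2^-1 *: (s + t)) ^+ 2.
    have -> : (x - s) + (x - t) = 2 *: (x - 2^-1 *: (s + t)).
      rewrite scalerBr scalerA divff ?pnatr_eq0// scale1r scaler_nat mulr2n.
      by rewrite opprD addrACA.
    apply: complexI; rewrite -norm2E normrZ exprMn norm2E [RHS]rmorphM.
    by rewrite ger0_norm ?ler0n// -natrX /= rmorph_nat.
  have : N ((x - s) + (x - t)) ^+ 2 + N (s - t) ^+ 2 =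
      (N (x - s) ^+ 2 + N (x - t) ^+ 2) *+ 2.
    apply: complexI; rewrite rmorphD rmorphMn rmorphD /= -!norm2E -parallelogram.
    by congr (_ + _ ^+ 2); rewrite -(subrKA x) addrC -(opprB x s) distrC.
  by move=> *; lra.
have : cauchy F.
  apply: cauchy_exP => e e0.
  have eE : e = (complex.Re e)%:C%C by rewrite RRe_real// gtr0_real.
  move: e0; rewrite eE; set r := complex.Re e; rewrite ltcR => r0.
  (* by [A_dist], the set [A (r ^+ 2 / 4)] lies in a ball of radius [r] *)
  have e0 : 0 < r ^+ 2 / 4 by rewrite divr_gt0// exprn_gt0.
  have [s As] := filter_ex (FA _ e0).
  exists s, (r ^+ 2 / 4) => // t At.
  rewrite -ball_normE /= normE ltcR.
  have := A_dist _ _ _ As At; rewrite mulrC divfK// ltr_pXn2r// nnegrE; last exact: ltW.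
  by rewrite -ler0c -normE.
move=> /cauchy_cvg/cvg_ex[y Fy]; exists y; split.
  apply: (@closed_cvg _ _ F _ id S clS _ y Fy).
  by exists 1 => [|s []] /=.
move=> z Sz; apply: (@eq0_le_small _ (`|z| *+ 2)) => e e0.
have e20 : 0 < e ^+ 2 by rewrite exprn_gt0.
have [s [[Ss ds] ys]] : A (e ^+ 2) `&` ball y e%:C%C !=set0.
  apply: (@filter_ex _ F); apply: filterI; first by apply: (FA (e ^+ 2)).
  by apply: Fy; apply: nbhsx_ballx; rewrite ltcR.
have -> : x - y = (x - s) - (y - s) by rewrite opprB addrA subrK.
rewrite innerBl (le_trans (ler_normB _ _))// mulrnAr mulr2n lerD//.
  rewrite -(ler_pXn2r (_ : 0 < 2)%N)// ?nnegrE ?mulr_ge0// ?ler0c ?(ltW e0)//.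
  apply: le_trans (inner_sqr_le_defect (m := d%:C%C) _) _ => [a|].
    rewrite norm2E lecR addrAC -addrA -opprD; apply: d_le.
    exact: Slin.
  rewrite exprMn ler_wpM2r ?exprn_ge0// norm2E -rmorphB -rmorphXn lecR.
  by rewrite lerBlDl ltW.
rewrite (le_trans (inner_le_norm _ _))// ler_wpM2r//.
by move: ys; rewrite -ball_normE /= => /ltW.
Qed.

Section ProjOnto.
Variables (S : set H) (Ssub : closed_subspace S).

Lemma proj_onto_unique x y :
  S y -> (forall z, S z -> '[x - y, z] = 0) -> proj_onto S x = y.
Proof.
move=> Sy xy; apply: xget_unique => // y' [Sy' xy'].
case: Ssub => _ _ Slin; apply/eqP; rewrite -subr_eq0 -(dnorm_eq0 (inner H)).
have Sd : S (y' - y) by rewrite addrC -scaleN1r; apply: Slin.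
rewrite -[X in '[X, _]](subrKA x) addrC -[y' - x]opprB innerBl.
by rewrite xy// xy'// subrr.
Qed.

Lemma proj_onto_spec x :
  S (proj_onto S x) /\ forall z, S z -> '[x - proj_onto S x, z] = 0.
Proof.
have [y [Sy xy]] := projection_theorem x Ssub.
by rewrite (proj_onto_unique Sy xy).
Qed.

Lemma proj_onto_in x : S (proj_onto S x).
Proof. by have [] := proj_onto_spec x. Qed.

Lemma proj_onto_id x : S x -> proj_onto S x = x.
Proof.
by move=> Sx; apply: proj_onto_unique => // z _; rewrite subrr inner0l.
Qed.

Lemma proj_onto_innerl x z : S z -> '[proj_onto S x, z] = '[x, z].
Proof.
move=> Sz; have [_ /(_ z Sz)/eqP] := proj_onto_spec x.
by rewrite innerBl subr_eq0 => /eqP.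
Qed.

Lemma proj_onto_sym x y : '[proj_onto S x, y] = '[x, proj_onto S y].
Proof.
rewrite -[RHS]proj_onto_innerl; last exact: proj_onto_in.
by rewrite innerC -proj_onto_innerl -?innerC//; apply: proj_onto_in.
Qed.

Lemma proj_onto_eq0 x : (forall z, S z -> '[x, z] = 0) -> proj_onto S x = 0.
Proof.
move=> xS; apply: proj_onto_unique; first by case: Ssub.
by move=> z /xS; rewrite subr0.
Qed.

Lemma proj_onto_linear : linear (proj_onto S).
Proof.
move=> a u v; apply: inner_extl => w.
by rewrite proj_onto_sym !(innerDl, innerZl) !proj_onto_sym.
Qed.

Lemma proj_onto_norm x : `|proj_onto S x| <= `|x|.
Proof.
have [->|p0] := eqVneq (proj_onto S x) 0; first by rewrite normr0.
rewrite -(ler_pM2r (_ : 0 < `|proj_onto S x|)) ?normr_gt0// -expr2.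
rewrite -[_ ^+ 2]ger0_norm ?exprn_ge0// -inner_norm.
by rewrite proj_onto_innerl ?inner_le_norm//; apply: proj_onto_in.
Qed.

End ProjOnto.

(** * Adjoints *)

(** A nonzero vector [u] orthogonal to the kernel of [f] spans a complement of
    that kernel, which has codimension one; [z] is the multiple of [u] on which
    [f] and the inner product agree. *)
Lemma riesz_representation (f : H -> R[i]) (M : R[i]) : 0 <= M ->
    (forall a u v, f (a *: u + v) = a * f u + f v) ->
    (forall u, `|f u| <= M * `|u|) ->
  exists z, forall x, f x = '[x, z].
Proof.
move=> M0 f_lin f_bd.
have f0 : f 0 = 0.
  by have := f_lin 1 0 0; rewrite scaler0 addr0 mul1r => /eqP; rewrite addrC -subr_eq subrr eq_sym => /eqP.
have f_sub u v : f (u - v) = f u - f v.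
  by rewrite addrC -scaleN1r f_lin mulN1r addrC.
have ker_sub : closed_subspace [set u | f u = 0].
  split=> //=; last by move=> a u v fu fv; rewrite f_lin fu fv mulr0 addr0.
  by apply: (closed_zeros M0) => u v; rewrite -f_sub.
have [f_eq0|] := pselect (forall x, f x = 0).
  by exists 0 => x; rewrite f_eq0 inner0r.
move=> /existsNP[x0 /eqP fx0].
set K := [set u | f u = 0] in ker_sub.
have [pK uK] := proj_onto_spec ker_sub x0.
set u := x0 - proj_onto K x0 in uK.
have fu0 : f u != 0 by rewrite f_sub (pK : f _ = 0) subr0.
have uu0 : '[u, u] != 0.
  by rewrite dnorm_eq0; apply: contra fu0 => /eqP ->; rewrite f0.
exists ((f u / '[u, u])^* *: u) => x; rewrite innerZr conjCK.
have xK : K (x - (f x / f u) *: u).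
  by rewrite /K /= f_sub -[_ *: u]addr0 f_lin f0 addr0 divfK// subrr.
have /eqP : '[x - (f x / f u) *: u, u] = 0 by rewrite innerC uK// conjC0.
rewrite innerBl innerZl subr_eq0 => /eqP ->.
by field; rewrite fu0 uu0.
Qed.

(** The inner product separates points, so a map satisfying the adjoint
    identity is the adjoint; this identifies adjoints of explicit products. *)
Lemma adjoint_unique (T A : H -> H) :
  (forall x y, '[T x, y] = '[x, A y]) -> adjoint T = A.
Proof.
move=> TA; apply/funext => y; apply: xget_unique => [x|z Tz] //.
by apply: inner_extr => w; rewrite -Tz.
Qed.

Lemma adjointP (T : H -> H) : bounded_operator T ->
  forall x y, '[T x, y] = '[x, adjoint T y].
Proof.
move=> [T_lin [M T_bd]] x y; rewrite /adjoint; case: xgetP => [z _ -> //|noz].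
have [z zP] : exists z, forall x, '[T x, y] = '[x, z].
  apply: (@riesz_representation _ (`|M|%:C%C * `|y|)).
  - by rewrite mulr_ge0// ler0c.
  - by move=> a u v; rewrite T_lin innerDl innerZl.
  - move=> u; rewrite (le_trans (inner_le_norm _ _))// mulrAC ler_wpM2r//.
    by rewrite (le_trans (T_bd u))// ler_wpM2r// lecR ler_norm.
by have := noz z zP.
Qed.

Lemma adjointPl (T : H -> H) : bounded_operator T ->
  forall x y, '[adjoint T x, y] = '[x, T y].
Proof. by move=> bT x y; rewrite innerC -adjointP// -innerC. Qed.

Lemma adjoint_linear (T : H -> H) : bounded_operator T -> linear (adjoint T).
Proof.
move=> bT a u v; apply: inner_extl => w.
by rewrite adjointPl// !innerDl !innerZl !adjointPl.
Qed.

Lemma projection_proj_onto S : closed_subspace S -> projection (proj_onto S).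
Proof.
move=> Ssub; split.
- split; first exact: proj_onto_linear.
  by exists 1 => x; rewrite mul1r proj_onto_norm.
- by symmetry; apply: adjoint_unique => x y; apply: proj_onto_sym.
- by apply/funext => x /=; rewrite [RHS]proj_onto_id//; apply: proj_onto_in.
Qed.

(** * Closed ranges *)

(** This replaces every continuity argument about operators by the continuity
    of the inner product in its first argument. *)
Lemma orthogonal_closure S w :
  (forall s, S s -> '[s, w] = 0) -> forall s, closure S s -> '[s, w] = 0.
Proof.
move=> Sw; have cl_w : closed [set u | '[u, w] = 0].
  apply: (@closed_zeros _ `|w|) => // u v.
  by rewrite -innerBl mulrC inner_le_norm.
by move=> s /(closureS Sw)/cl_w.
Qed.

Lemma closed_subspace_closure_range (T : H -> H) :
  linear T -> closed_subspace (closure (range T)).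
Proof.
move=> T_lin; split; first exact: closed_closure.
  apply: subset_closure; exists (T 0 - T 0) => //.
  by rewrite -[T 0 - T 0]addrC -scaleN1r T_lin scaleN1r addrC subrr.
move=> a u v clu clv B /= nbB.
have /(_ B nbB) [[U V] [/= nbU nbV] UVB] :
    (a *: p.1 + p.2) @[p --> (u, v)] --> a *: u + v.
  apply: cvgD; last exact: cvg_snd.
  by apply: cvgZr; apply: cvg_fst.
have [_ [[x _ <-] Ux]] := clu _ nbU; have [_ [[y _ <-] Vy]] := clv _ nbV.
exists (a *: T x + T y); split; last exact: (UVB (_, _)).
by exists (a *: x + y); rewrite ?T_lin.
Qed.


Lemma projection_sym (E : H -> H) : projection E ->
  forall x y, '[E x, y] = '[x, E y].
Proof. by case=> bE Eadj _ x y; rewrite adjointP// -Eadj. Qed.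

(** Since [E] is symmetric, [E s = s] can be tested on each [w] as the
    orthogonality of [s] to [E w - w]. *)
Lemma closure_fixed (E : H -> H) S : projection E ->
  (forall s, S s -> E s = s) -> forall s, closure S s -> E s = s.
Proof.
move=> pE ES s cls; apply: inner_extl => w.
apply/eqP; rewrite projection_sym// -subr_eq0 -innerBr.
apply/eqP; apply: orthogonal_closure cls => t St.
by rewrite innerBr -projection_sym// ES// subrr.
Qed.

(** * Products of two projections *)

Section RangeProjections.
Variables (T : H -> H) (bT : bounded_operator T).

Let P := proj_onto (closure (range T)).
Let Q := proj_onto (closure (range (adjoint T))).

Lemma closed_subspace_range : closed_subspace (closure (range T)).
Proof. by apply: closed_subspace_closure_range; case: bT. Qed.

Lemma closed_subspace_range_adjoint :
  closed_subspace (closure (range (adjoint T))).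
Proof. exact/closed_subspace_closure_range/adjoint_linear. Qed.

Lemma proj_range_fixed x : P (T x) = T x.
Proof.
apply: proj_onto_id; first exact: closed_subspace_range.
by apply: subset_closure; exists x.
Qed.

Lemma proj_range_adjoint_fixed x : Q (adjoint T x) = adjoint T x.
Proof.
apply: proj_onto_id; first exact: closed_subspace_range_adjoint.
by apply: subset_closure; exists x.
Qed.

Lemma proj_rangeE x y : '[P x, y] = '[x, P y].
Proof. exact/proj_onto_sym/closed_subspace_range. Qed.

Lemma proj_range_adjointE x y : '[Q x, y] = '[x, Q y].
Proof. exact/proj_onto_sym/closed_subspace_range_adjoint. Qed.

Lemma comp_proj_range_adjoint x : T (Q x) = T x.
Proof.
apply: inner_extl => w.
by rewrite !(adjointP bT) proj_range_adjointE proj_range_adjoint_fixed.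
Qed.

Lemma adjoint_comp_proj_range x : adjoint T (P x) = adjoint T x.
Proof.
apply: inner_extl => w.
by rewrite !(adjointPl bT) proj_rangeE proj_range_fixed.
Qed.

(** The kernel of [T] is orthogonal to the range of the adjoint. *)
Lemma proj_range_adjoint_ker x : T x = 0 -> Q x = 0.
Proof.
move=> Tx0; apply: proj_onto_eq0; first exact: closed_subspace_range_adjoint.
move=> z clz; rewrite innerC (orthogonal_closure _ clz) ?conjC0//.
by move=> _ [y _ <-]; rewrite (adjointPl bT) Tx0 inner0r.
Qed.

(** [P1] and [P2] project onto subspaces that contain the closed ranges of [T]
    and of its adjoint, so [P] absorbs [P1] and [Q] absorbs [P2] in
    [T = P T Q = P P1 P2 Q]. *)
Lemma factors_absorb (P1 P2 : H -> H) : projection P1 -> projection P2 ->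
  T = P1 \o P2 -> T = P \o Q.
Proof.
move=> pP1 pP2 TE.
have idem1 x : P1 (P1 x) = P1 x by have [_ _ /(congr1 (@^~ x))] := pP1.
have idem2 x : P2 (P2 x) = P2 x by have [_ _ /(congr1 (@^~ x))] := pP2.
have TadjE : adjoint T = P2 \o P1.
  by apply: adjoint_unique => x y; rewrite TE /= !projection_sym.
have P1P x : P1 (P x) = P x.
  apply: (closure_fixed pP1 _ (proj_onto_in closed_subspace_range x)).
  by move=> _ [y _ <-]; rewrite TE /= idem1.
have P2Q x : P2 (Q x) = Q x.
  apply: (closure_fixed pP2 _ (proj_onto_in closed_subspace_range_adjoint x)).
  by move=> _ [y _ <-]; rewrite TadjE /= idem2.
have PP1 x : P (P1 x) = P x.
  by apply: inner_extl => w; rewrite !(proj_rangeE, projection_sym) ?P1P.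
apply/funext => x /=.
by rewrite -comp_proj_range_adjoint -proj_range_fixed TE /= P2Q PP1.
Qed.

Lemma comp_adjoint_of_factorization :
  T = P \o Q -> T \o adjoint T = T \o P.
Proof.
move=> TE; have TadjE : adjoint T = Q \o P.
  apply: adjoint_unique => x y.
  by rewrite [in LHS]TE /= proj_rangeE proj_range_adjointE.
by apply/funext => x; rewrite TadjE /= comp_proj_range_adjoint.
Qed.

(** The hypothesis reads [T (T* - 1) T = 0].  Passing to the closure of the
    range turns it into [T (T* - P) = 0], and [Q] kills the kernel of [T], so
    [T* = Q T* = Q P]. *)
Lemma factorization_of_cubic :
  T \o adjoint T \o T = T \o T -> T = P \o Q.
Proof.
move=> TTT.
have on_range s : closure (range T) s -> T (adjoint T s) = T s.
  move=> cls; apply: inner_extl => w.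
  apply/eqP; rewrite !(adjointP bT) (adjointPl bT) -subr_eq0 -innerBr.
  apply/eqP; apply: orthogonal_closure cls => _ [x _ <-].
  rewrite innerBr -(adjointP bT) -(adjointPl bT) -(adjointP bT).
  by rewrite (congr1 (@^~ x) TTT : T (adjoint T (T x)) = T (T x)) subrr.
have TadjE y : adjoint T y = Q (P y).
  (* [T* = T* P], so [on_range] applies to the vector [P y] *)
  have Tker : T (adjoint T y - P y) = 0.
    have T_lin := bT.1; rewrite addrC -scaleN1r T_lin scaleN1r addrC.
    rewrite -adjoint_comp_proj_range on_range ?subrr//.
    by apply: proj_onto_in; apply: closed_subspace_range.
  have := proj_range_adjoint_ker Tker.
  have Q_lin := proj_onto_linear closed_subspace_range_adjoint.
  rewrite addrC -scaleN1r /Q Q_lin scaleN1r addrC => /eqP.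
  by rewrite subr_eq0 -/Q proj_range_adjoint_fixed => /eqP.
apply/funext => x; apply: inner_extl => w /=.
by rewrite (adjointP bT) TadjE proj_rangeE proj_range_adjointE.
Qed.

End RangeProjections.

End HilbertGeometry.

Theorem theorem2p6 (R : realType) (H : hilbertSpace R) (sepH : separable H)
    (T : H -> H) (bT : bounded_operator T) :
  [<-> (exists P1 P2 : H -> H,
          [/\ projection P1, projection P2 & T = P1 \o P2]);
       T = proj_onto (closure (range T)) \o
             proj_onto (closure (range (adjoint T)));
       T \o adjoint T = T \o proj_onto (closure (range T));
       T \o adjoint T \o T = T \o T].
Proof.
tfae.
- by move=> [P1 [P2 [pP1 pP2 TE]]]; apply: factors_absorb TE.
- exact: comp_adjoint_of_factorization.
- move=> TTadj; apply/funext => x /=.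
  rewrite (congr1 (@^~ (T x)) TTadj : T (adjoint T (T x)) = T _).
  by rewrite proj_range_fixed.
- move=> TTT; exists (proj_onto (closure (range T))).
  exists (proj_onto (closure (range (adjoint T)))); split.
  + exact/projection_proj_onto/closed_subspace_range.
  + exact/projection_proj_onto/closed_subspace_range_adjoint.
  + exact: factorization_of_cubic.
Qed.
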